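(* For every positive rational number $t<2/3$ there is a polynomial-time algorithm which, given a finite simple $3$-regular graph $G$, decides whether $G$ is $t$-tough.
   Context: All graphs are finite, simple and undirected; $\omega(H)$ denotes the number of connected components of $H$. For a real $t$, a graph $G$ is $t$-tough if $|S|\ge t\,\omega(G-S)$ for every $S\subseteq V(G)$ with $\omega(G-S)>1$. The toughness $\tau(G)$ is the largest $t$ for which $G$ is $t$-tough, with the convention $\tau(K_n)=\infty$ for all $n\ge1$. *)

(* Defs.v *)
From HB Require Import structures.
From mathcomp Require Import all_boot all_order all_algebra.

Set Implicit Arguments.
Unset Strict Implicit.
Unset Printing Implicit Defensive.

Import Order.TTheory GRing.Theory Num.Theory.

(* Finite simple undirected graphs, with vertex set {0, ..., order - 1}. *)
Record graph := Graph {
  order : nat;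
  adj : rel 'I_order;
  adj_sym : symmetric adj;
  adj_irr : irreflexive adj
}.

Definition regular (d : nat) (G : graph) : Prop :=
  forall x : 'I_(order G), #|[set y | adj x y]| = d.

Definition adj_minus (G : graph) (S : {set 'I_(order G)}) :
    rel 'I_(order G) :=
  [rel x y | [&& x \notin S, y \notin S & adj x y]].

(* The number of connected components of G - S; restricting the count to     *)
(* ~: S discards the vertices of S, which are isolated points of adj_minus.   *)
Definition omega_minus (G : graph) (S : {set 'I_(order G)}) : nat :=
  n_comp (adj_minus S) (~: S).

Definition tough (R : realFieldType) (t : R) (G : graph) : Prop :=
  forall S : {set 'I_(order G)},
    1 < omega_minus S -> (t * (omega_minus S)%:R <= #|S|%:R)%R.

(* The bit string 1^n 0 followed by the n x n adjacency matrix, row by row.   *)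
Definition encode (G : graph) : seq bool :=
  nseq (order G) true ++
  false :: [seq adj x y | x <- enum 'I_(order G), y <- enum 'I_(order G)].

(* Deterministic Turing machines with k.+1 two-way infinite tapes. The tape   *)
(* alphabet consists of the blank None, the input bits Some (inl b) and the   *)
(* work symbols Some (inr a). A state q is halting iff tm_verdict q is        *)
(* Some b, where b tells whether the machine accepts.                         *)
Inductive move := MoveLeft | Stay | MoveRight.

Definition symbol (A : finType) : finType := option (bool + A).

Record tm (k : nat) := TM {
  tm_state : finType;
  tm_work : finType;
  tm_start : tm_state;
  tm_verdict : tm_state -> option bool;
  tm_delta : tm_state -> {ffun 'I_k.+1 -> symbol tm_work} ->
             tm_state * {ffun 'I_k.+1 -> symbol tm_work * move}
}.

(* (l, r) is the tape with contents rev l ++ r, surrounded by blanks, and     *)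
(* with the head on the first symbol of r.                                    *)
Definition tape (A : finType) : Type := seq (symbol A) * seq (symbol A).

Definition tape_read (A : finType) (tp : tape A) : symbol A :=
  head None tp.2.

Definition tape_act (A : finType) (tp : tape A) (am : symbol A * move) :
    tape A :=
  let: (l, r) := tp in
  let: (a, m) := am in
  match m with
  | MoveLeft => (behead l, head None l :: a :: behead r)
  | Stay => (l, a :: behead r)
  | MoveRight => (a :: l, behead r)
  end.

Definition config (k : nat) (M : tm k) : Type :=
  tm_state M * {ffun 'I_k.+1 -> tape (tm_work M)}.

Definition tm_init (k : nat) (M : tm k) (w : seq bool) : config M :=
  (tm_start M,
   [ffun i : 'I_k.+1 =>
      if i == ord0 then ([::], [seq Some (inl b) | b <- w])
      else ([::], [::])]).

Definition tm_step (k : nat) (M : tm k) (c : config M) : config M :=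
  let: (q, tps) := c in
  if tm_verdict q is Some _ then c else
  let: (q', acts) := tm_delta q [ffun i => tape_read (tps i)] in
  (q', [ffun i => tape_act (tps i) (acts i)]).

(* Halting configurations are fixed points of tm_step, so this is Some b iff  *)
(* M halts on w after at most s steps, with verdict b.                        *)
Definition tm_run (k : nat) (M : tm k) (w : seq bool) (s : nat) : option bool :=
  tm_verdict (iter s (@tm_step k M) (tm_init M w)).1.

(* Some Turing machine decides, in time polynomial in the length of the       *)
(* encoding, whether P x holds for the instances x that satisfy D.            *)
Definition poly_time_decidable (I : Type) (enc : I -> seq bool)
    (D P : I -> Prop) : Prop :=
  exists (k : nat) (M : tm k) (p : {poly nat}),
    forall x : I, D x ->
      exists b : bool,
        tm_run M (enc x) p.[size (enc x)]%R = Some b /\ (b <-> P x).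

(* Main.v *)
Require Import Defs.
From HB Require Import structures.
From mathcomp Require Import all_boot all_order all_algebra.
From mathcomp Require Import zify lra.

(* Let G be connected and cubic. Deleting a vertex creates at most two new    *)
(* components, so omega(G - S) <= 1 + 2|S|, and omega(G - S) <= 2|S| for      *)
(* nonempty S if no single vertex leaves three components. If G has no cut    *)
(* vertex, each of the at least two components of G - S sends two edges to S, *)
(* whence 2 omega(G - S) <= 3|S|. Hence, for fixed t < 2/3, a violation of    *)
(* t-toughness is already witnessed by a set S of size at most some K(t):     *)
(* |S| < t / (1 - 2t) if t < 1/2, and |S| <= 1 if 1/2 <= t < 2/3. There are   *)
(* at most (n + 1)^K such sets. The machine enumerates them and, for each,    *)
(* counts the components of G - S by a closure computation.                   *)

Set Implicit Arguments.
Unset Strict Implicit.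
Unset Printing Implicit Defensive.

Import Order.TTheory GRing.Theory Num.Theory.

(** The argument has two independent halves. The combinatorial half is [bounded_cuts_suffice]: a
    bound K, depending on t but not on G, such that checking the sets of at most K vertices
    suffices. The empty set is among them and detects a disconnected G. For connected G the
    estimates are [omega_minus_growth], where a vertex of degree 3 adds at most two components, and
    [omega_minus_le32], a double count based on [two_edges_out]. The algorithmic half is a machine
    whose tapes hold only S and a set of marked vertices. Since K is constant, and by [violates_cap]
    components need counting only up to a constant C, all counters fit in the finite control.
    [cycles_run] reduces correctness of the machine to an invariant on lists of cells,
    [invariant_step] maintains it, and [checker_run] adds up the time. *)

Lemma leq_card_inj_in (T T' : finType) (f : T -> T') (A : {set T})
    (B : {set T'}) :
  {in A, forall x, f x \in B} -> {in A &, injective f} -> #|A| <= #|B|.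
Proof.
move=> fAB /card_in_imset <-; apply/subset_leq_card/subsetP => _ /imsetP[x xA ->].
exact: fAB.
Qed.

Lemma size_flatten_const (T : Type) n (rows : seq (seq T)) :
  all (fun r => size r == n) rows -> size (flatten rows) = size rows * n.
Proof.
elim: rows => //= r rows IHrows /andP[/eqP sr /IHrows].
by rewrite size_cat sr mulSn => ->.
Qed.

(** * Components of G - S, counted by their canonical roots *)

Section Components.

Variable G : graph.
Implicit Types (S : {set 'I_(Defs.order G)}) (x y r : 'I_(Defs.order G)).

Definition neighbors x := [set y | adj x y].

Definition comp_roots S := [set r in ~: S | roots (adj_minus S) r].

Lemma omega_minusE S : omega_minus S = #|comp_roots S|.
Proof. by apply: eq_card => r; rewrite !inE andbC. Qed.

Lemma adj_minus_csym S : connect_sym (adj_minus S).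
Proof.
apply: sym_connect_sym => x y.
by rewrite /adj_minus /= adj_sym; case: (x \in S); case: (y \in S).
Qed.

Lemma connect_minus_notin S x y :
  connect (adj_minus S) x y -> (x \in S) = (y \in S).
Proof.
have cl : closed (adj_minus S) (mem S).
  by move=> u v /= /and3P[/negbTE uS /negbTE vS _]; exact: etrans uS (esym vS).
exact: closed_connect.
Qed.

Lemma comp_roots_root S x : x \notin S -> fingraph.root (adj_minus S) x \in comp_roots S.
Proof.
move=> xS; rewrite !inE roots_root ?andbT; last exact: adj_minus_csym.
by rewrite -(connect_minus_notin (connect_root _ x)).
Qed.

Lemma comp_roots_inj S r1 r2 : r1 \in comp_roots S -> r2 \in comp_roots S ->
  connect (adj_minus S) r1 r2 -> r1 = r2.
Proof.
rewrite !inE => /andP[_ /eqP r1E] /andP[_ /eqP r2E].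
by rewrite -root_connect ?r1E ?r2E; [move/eqP | apply: adj_minus_csym].
Qed.

(** A path that starts outside the component of x never meets x, so it survives the deletion of
    x. *)
Lemma connect_minus_avoid S x y z : connect (adj_minus S) y z ->
  ~~ connect (adj_minus S) y x -> connect (adj_minus (x |: S)) y z.
Proof.
case/connectP=> p; elim: p y => [|y1 p IHp] y /=; first by move=> _ -> .
case/andP=> /[dup] yy1 /and3P[yS y1S ayy1] pth zE nyx.
have ny1x : ~~ connect (adj_minus S) y1 x.
  by apply: contra nyx; apply/connect_trans/connect1.
apply: connect_trans (IHp _ pth zE ny1x); apply: connect1.
rewrite /adj_minus /= !inE !negb_or yS y1S ayy1 !andbT.
by apply/andP; split; [apply: contra nyx|apply: contra ny1x] => /eqP->;
  rewrite connect0.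
Qed.

(** Here z is the vertex just before the first visit to x. *)
Lemma connect_minus_last S x y : connect (adj_minus S) y x -> y != x ->
  exists2 z, z \in neighbors x & connect (adj_minus (x |: S)) y z.
Proof.
case/connectP=> p; elim: p y => [|y1 p IHp] y /=; first by move=> _ ->; rewrite eqxx.
case/andP=> /and3P[yS y1S ayy1] pth xE yx.
have [y1x|y1x] := eqVneq y1 x.
  by exists y; rewrite ?connect0 // inE -y1x adj_sym.
have [z xz y1z] := IHp _ pth xE y1x; exists z => //.
by apply: connect_trans y1z; apply/connect1; rewrite /adj_minus /= !inE !negb_or yx yS y1x y1S.
Qed.

(** The components of G - S - x inside the component of x each contain a neighbor of x; the others
    inject into the components of G - S that miss x. *)
Lemma omega_minusU1 S x : x \notin S ->
  omega_minus (x |: S) < omega_minus S + #|neighbors x|.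
Proof.
move=> xS; rewrite !omega_minusE.
pose near := [set r | connect (adj_minus S) r x].
rewrite -(cardsID near (comp_roots _)).
have rootsU r : r \in comp_roots (x |: S) -> r != x /\ r \notin S.
  by rewrite !inE negb_or => /andP[/andP[-> ->]].
have le1 : #|comp_roots (x |: S) :&: near| <= #|neighbors x|.
  pose P r z := (z \in neighbors x) && connect (adj_minus (x |: S)) r z.
  (* On the roots considered a suitable neighbor exists, so the default [r] is never returned. *)
  pose f r := odflt r [pick z | P r z].
  have fP r : r \in comp_roots (x |: S) :&: near -> P r (f r).
    case/setIP => /rootsU[rx _]; rewrite inE => rcx; rewrite /f.
    case: pickP => [z //|/= Pr]; have [z zx rz] := connect_minus_last rcx rx.
    by have := Pr z; rewrite /P zx rz.
  apply: (@leq_card_inj_in _ _ f) => [r rR|]; first by case/andP: (fP r rR).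
  move=> r1 r2 r1R r2R fE.
  have /andP[_ r1f] := fP _ r1R; have /andP[_ r2f] := fP _ r2R.
  case/setIP: r1R => r1R _; case/setIP: r2R => r2R _.
  apply: comp_roots_inj r1R r2R _; rewrite fE in r1f.
  by apply: connect_trans r1f _; rewrite adj_minus_csym.
suff lt2 : #|comp_roots (x |: S) :\: near| < #|comp_roots S|.
  by rewrite addnC -addSn leq_add.
rewrite [X in _ < X](cardsD1 (fingraph.root (adj_minus S) x)) comp_roots_root // ltnS.
apply: (@leq_card_inj_in _ _ (fingraph.root (adj_minus S))).
  move=> r /setDP[/rootsU[_ rS] rx].
  rewrite !in_setD1 comp_roots_root // andbT root_connect //.
    by apply: contra rx; rewrite inE.
  exact: adj_minus_csym.
move=> r1 r2 /setDP[r1R r1x] /setDP[r2R _] /eqP.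
rewrite root_connect; last exact: adj_minus_csym.
move=> r12; apply: comp_roots_inj r1R r2R _.
by apply: connect_minus_avoid r12 _; rewrite inE in r1x.
Qed.

(** * Bounds on the number of components in cubic graphs *)

Section Cubic.

Hypothesis G3 : regular 3 G.

Lemma omega_minus_growth S S' : S \subset S' ->
  omega_minus S' <= omega_minus S + 2 * #|S' :\: S|.
Proof.
move=> sub; have [n] := ubnP #|S' :\: S|; elim: n S sub => // n IHn S sub ltn.
have [E|[x]] := set_0Vmem (S' :\: S).
  rewrite E cards0 muln0 addn0 (_ : S = S') //.
  by apply/eqP; rewrite eqEsubset sub -setD_eq0 E /=.
case/setDP=> xS' xS.
have D : S' :\: S = x |: (S' :\: (x |: S)).
  apply/setP=> y; rewrite !inE; case: eqVneq => // ->; by rewrite xS xS'.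
have xD : x \notin S' :\: (x |: S) by rewrite !inE eqxx.
have subx : x |: S \subset S' by rewrite subUset sub1set xS'.
have := IHn _ subx; have := omega_minusU1 xS; rewrite /neighbors G3.
move: ltn; rewrite D cardsU1 xD add1n.
move: (#|_|) (omega_minus _) (omega_minus _) (omega_minus _) => a b c d; lia.
Qed.

Lemma omega_minus_le S : omega_minus (set0 : {set 'I_(Defs.order G)}) <= 1 ->
  omega_minus S <= 1 + 2 * #|S|.
Proof. by have := omega_minus_growth (sub0set S); rewrite setD0; lia. Qed.

(** Growing S from one of its vertices instead of from the empty set saves the summand 1: the count
    is at most 2 + 2(|S| - 1). *)
Lemma omega_minus_le2 S :
  (forall x, omega_minus [set x] <= 2) -> S != set0 -> omega_minus S <= 2 * #|S|.
Proof.
move=> le2 /set0Pn[x xS]; have := le2 x.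
have /omega_minus_growth : [set x] \subset S by rewrite sub1set.
rewrite (cardsD1 x S) xS add1n.
move: (#|_|) (omega_minus _) (omega_minus _) => a b c; lia.
Qed.

(** If at most one vertex of S were adjacent to the component of r, deleting that vertex alone, or
    nothing, would already separate r from r'. *)
Lemma two_edges_out S r r' : omega_minus (set0 : {set 'I_(Defs.order G)}) <= 1 ->
  (forall x, omega_minus [set x] <= 1) ->
  r \notin S -> r' \notin S -> ~~ connect (adj_minus S) r r' ->
  1 < #|[set s in S | [exists y, connect (adj_minus S) r y && adj s y]]|.
Proof.
move=> le0 le1 rS r'S nrr'; set N := [set s in S | _]; rewrite ltnNge; apply/negP.
(* When S0 contains all the attachment vertices, the component of r in G - S is still closed in G -
   S0. *)
have sep S0 : S0 \subset S -> omega_minus S0 <= 1 -> ~~ (N \subset S0).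
  move=> S0S; rewrite omega_minusE; apply: contraL => NS0.
  have S0r u : u \notin S -> u \notin S0 by apply/contra/(subsetP S0S).
  have cl : closed (adj_minus S0) (connect (adj_minus S) r).
    apply: intro_closed; first exact: adj_minus_csym.
    move=> u v /= /and3P[uS0 vS0 auv] ru; apply: (connect_trans ru).
    have uS : u \notin S by rewrite -(connect_minus_notin ru).
    apply: connect1; rewrite /adj_minus /= uS auv andbT; apply: contra vS0 => vS.
    apply: (subsetP NS0); rewrite inE vS; apply/existsP; exists u.
    by rewrite adj_sym auv andbT.
  rewrite -ltnNge; apply/card_gt1P; 
  exists (fingraph.root (adj_minus S0) r), (fingraph.root (adj_minus S0) r').
  rewrite !comp_roots_root ?S0r //; split=> //; rewrite root_connect; last exact: adj_minus_csym.
  apply: contra nrr' => /(closed_connect cl); by rewrite inE connect0 inE => <-.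
rewrite leq_eqVlt ltnS leqn0 => /orP[/cards1P[x NE]|].
  have xS : x \in S by have := set11 x; rewrite -NE inE => /andP[].
  by have := sep [set x]; rewrite sub1set xS le1 NE subxx => /(_ isT isT).
by rewrite cards_eq0 => /eqP NE; have := sep set0; rewrite sub0set le0 NE subxx => /(_ isT isT).
Qed.

(** Double counting of the pairs of a component and a vertex of S adjacent to it: each component is
    in at least two pairs, each vertex in at most three. *)
Lemma omega_minus_le32 S : omega_minus (set0 : {set 'I_(Defs.order G)}) <= 1 ->
  (forall x, omega_minus [set x] <= 1) -> 1 < omega_minus S ->
  2 * omega_minus S <= 3 * #|S|.
Proof.
move=> le0 le1 gt1.
pose N r := [set s in S | [exists y, connect (adj_minus S) r y && adj s y]].
have N2 r : r \in comp_roots S -> 2 <= #|N r|.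
  move=> rR; move: gt1; rewrite omega_minusE => /card_gt1P[r1 [r2 [r1R r2R r12]]].
  have [r' r'R r'r] : exists2 r', r' \in comp_roots S & r != r'.
    by have [E|] := eqVneq r r1; [exists r2; rewrite // E|exists r1].
  apply: (@two_edges_out _ _ r') => //.
  - by move: rR; rewrite !inE => /andP[].
  - by move: r'R; rewrite !inE => /andP[].
  by apply: contra r'r => /(comp_roots_inj rR r'R)->.
have le3 s : #|[set r in comp_roots S | s \in N r]| <= 3.
  rewrite -(G3 s) -[X in _ <= X]/(#|neighbors s|).
  pose P r z := connect (adj_minus S) r z && adj s z.
  pose f r := odflt r [pick z | P r z].
  have fP r : r \in [set r in comp_roots S | s \in N r] -> P r (f r).
    rewrite !in_set => /andP[_ /andP[_ /existsP[z Pz]]]; rewrite /f.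
    by case: pickP => [//|/(_ z)]; rewrite /P Pz.
  apply: (@leq_card_inj_in _ _ f) => [r rR|].
    by case/andP: (fP r rR); rewrite inE.
  move=> r1 r2 r1R r2R fE.
  have /andP[r1f _] := fP _ r1R; have /andP[r2f _] := fP _ r2R.
  case/setIdP: r1R => r1R _; case/setIdP: r2R => r2R _.
  apply: comp_roots_inj r1R r2R _; rewrite fE in r1f.
  by apply: connect_trans r1f _; rewrite adj_minus_csym.
rewrite mulnC omega_minusE -sum_nat_const mulnC -sum_nat_const.
apply: leq_trans (leq_sum _ _) _; first exact: N2.
have -> : \sum_(r in comp_roots S) #|N r| =
          \sum_(s in S) #|[set r in comp_roots S | s \in N r]|.
  under eq_bigr => r _ do rewrite -sum1_card.
  under [RHS]eq_bigr => s _ do rewrite -sum1_card.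
  rewrite (exchange_big_dep (mem S)) /=; last by move=> r s _; rewrite inE => /andP[].
  by apply: eq_bigr => s sS; apply: eq_bigl => r; rewrite !inE sS.
by apply: leq_sum => s _; apply: le3.
Qed.

End Cubic.

End Components.

(** * Reduction to vertex sets of bounded size *)

(** Stated on the two numbers alone, so that a finite control holding both as counters can evaluate
    it. *)
Definition violates (t : rat) (s c : nat) : bool :=
  (1 < c) && (s%:R < t * c%:R)%R.

Lemma toughP t G :
  tough t G <->
  forall S : {set 'I_(Defs.order G)}, ~~ violates t #|S| (omega_minus S).
Proof.
split=> H S; first by rewrite /violates; case: ltnP => //= /H; rewrite ltNge => ->.
by move=> gt1; have := H S; rewrite /violates gt1 /= -leNgt.
Qed.

Section BoundedCuts.

Variables (t : rat) (G : graph).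
Hypotheses (t_gt0 : (0 < t)%R) (G3 : regular 3 G).

Implicit Type S : {set 'I_(Defs.order G)}.

Lemma omega_minus0_le1 :
  ~~ violates t 0 (omega_minus (set0 : {set 'I_(Defs.order G)})) ->
  omega_minus (set0 : {set 'I_(Defs.order G)}) <= 1.
Proof.
rewrite /violates; case: ltnP => //= gt1.
by rewrite mulr_gt0 ?ltr0n // (ltn_trans _ gt1).
Qed.

(** Solve |S| < t(1 + 2|S|) for |S|, using 1 - 2t > 0. *)
Lemma violating_small S :
  omega_minus (set0 : {set 'I_(Defs.order G)}) <= 1 ->
  (t < 1 / 2)%R -> violates t #|S| (omega_minus S) ->
  (#|S|%:R < t / (1 - 2 * t))%R.
Proof.
move=> le1 t_lt /andP[_ lt].
have := omega_minus_le G3 S le1; rewrite -(ler_nat rat) natrD natrM => le.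
have := ler_wpM2l (ltW t_gt0) le; move: lt.
rewrite ltr_pdivlMr; last by lra.
move: (#|S|%:R : rat)%R ((omega_minus S)%:R : rat)%R => s c; lra.
Qed.

Lemma singletons_suffice S : (t < 2 / 3)%R -> (1 / 2 <= t)%R ->
  (forall S' : {set 'I_(Defs.order G)}, #|S'| <= 1 ->
    ~~ violates t #|S'| (omega_minus S')) ->
  ~~ violates t #|S| (omega_minus S).
Proof.
move=> t_lt t_ge ok.
have le1 : omega_minus (set0 : {set 'I_(Defs.order G)}) <= 1.
  by apply: omega_minus0_le1; rewrite -[0](@cards0 'I_(Defs.order G)) ok ?cards0.
have [->|S0] := eqVneq S set0; first by rewrite ok // cards0.
rewrite /violates; case: ltnP => //= gt1; rewrite -leNgt.
(* For t = 1/2 a cut vertex leaving two components is no violation, so only the bound 2|S| is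
   available, and it is just enough. For t > 1/2 any cut vertex is a violation, since 1 < 2t. *)
have [t_half|t_gt] : t = (1 / 2)%R \/ (1 / 2 < t)%R.
  by move: t_ge; rewrite le_eqVlt => /orP[/eqP|]; [left|right].
  have le2 (x : 'I_(Defs.order G)) : omega_minus [set x] <= 2.
    have := ok [set x]; rewrite cards1 /violates => /(_ isT); case: ltnP => [_ /=|]; last by lia.
    by rewrite -leNgt -(ler_nat rat) t_half; lra.
  by have := omega_minus_le2 G3 le2 S0; rewrite -(ler_nat rat) natrM t_half; lra.
have le1' (x : 'I_(Defs.order G)) : omega_minus [set x] <= 1.
  have := ok [set x]; rewrite cards1 /violates => /(_ isT); case: ltnP => //= gt1x.
  by move: gt1x; rewrite -leNgt -(ler_nat rat) => ? ?; exfalso; nra.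
have := omega_minus_le32 G3 le1 le1' gt1; rewrite -(ler_nat rat) !natrM => le.
have : (0 <= (omega_minus S)%:R :> rat)%R by apply: ler0n.
nra.
Qed.

End BoundedCuts.

Lemma bounded_cuts_suffice (t : rat) : (0 < t)%R -> (t < 2 / 3)%R ->
  exists K, forall G, regular 3 G ->
    (forall S : {set 'I_(Defs.order G)}, #|S| <= K ->
      ~~ violates t #|S| (omega_minus S)) ->
    tough t G.
Proof.
move=> t_gt0 t_lt; have [t_ge|t_lt2] := lerP (1 / 2)%R t.
  by exists 1 => G G3 ok; apply/toughP => S; apply: singletons_suffice.
have r_ge0 : (0 <= t / (1 - 2 * t))%R by rewrite divr_ge0 //; lra.
exists (Num.bound (t / (1 - 2 * t)))%R => G G3 ok; apply/toughP => S.
have [/ok//|ltK] := leqP #|S| (Num.bound (t / (1 - 2 * t)))%R.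
have le1 : omega_minus (set0 : {set 'I_(Defs.order G)}) <= 1.
  by apply: (omega_minus0_le1 t_gt0); rewrite -[0](@cards0 'I_(Defs.order G)) ok ?cards0.
apply/negP => vS; have lt := violating_small t_gt0 G3 le1 t_lt2 vS.
have := lt_trans lt (archi_boundP r_ge0); rewrite ltr_nat; lia.
Qed.

(** * Sweeping machines *)

(* The cell (s, m) of a vertex v records v \in S and whether v is marked. *)
Definition cell : Type := (bool * bool)%type.

(* Such a machine has three tapes, the input and two arrays with one cell per *)
(* vertex, "old" and "new", all delimited by walls; the first wall on the     *)
(* input tape replaces the separator in front of the adjacency matrix. One    *)
(* cycle runs the transducer delta over both arrays and overwrites both with  *)
(* its output; then, for each x, it streams row x of the matrix along the new *)
(* array and marks there the neighbors y outside S of each x that is marked   *)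
(* in the old array.                                                          *)
Section SweepingMachine.

Variables (Q : finType) (q0 : Q).
Variables (delta : Q -> cell -> cell -> Q * cell) (verdict : Q -> bool + Q).

Inductive state :=
  | Start | CopyOrder | SkipMatrix | Halt of bool
  | RewindInput of Q | RewindOld of Q | Control of Q | RewindCells of Q
  | RowStart of Q | RowSweep of Q | RewindNew of Q.

(** A sum of finite types from which [state] inherits its finite type structure. *)
Definition state_code (s : state) : ('I_3 + bool) + ('I_7 * Q) :=
  match s with
  | Start => inl (inl (@Ordinal 3 0 isT))
  | CopyOrder => inl (inl (@Ordinal 3 1 isT))
  | SkipMatrix => inl (inl (@Ordinal 3 2 isT))
  | Halt b => inl (inr b)
  | RewindInput q => inr (@Ordinal 7 0 isT, q)
  | RewindOld q => inr (@Ordinal 7 1 isT, q)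
  | Control q => inr (@Ordinal 7 2 isT, q)
  | RewindCells q => inr (@Ordinal 7 3 isT, q)
  | RowStart q => inr (@Ordinal 7 4 isT, q)
  | RowSweep q => inr (@Ordinal 7 5 isT, q)
  | RewindNew q => inr (@Ordinal 7 6 isT, q)
  end.

Definition state_decode (c : ('I_3 + bool) + ('I_7 * Q)) : state :=
  match c with
  | inl (inl i) => nth Start [:: Start; CopyOrder; SkipMatrix] i
  | inl (inr b) => Halt b
  | inr (i, q) => nth Start [:: RewindInput q; RewindOld q; Control q;
      RewindCells q; RowStart q; RowSweep q; RewindNew q] i
  end.

Lemma state_codeK : cancel state_code state_decode.
Proof. by case. Qed.

HB.instance Definition _ := Finite.copy state (can_type state_codeK).

Definition work : finType := option (bool * bool).
Definition sym : Type := option (bool + option (bool * bool)).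

Definition wall : sym := Some (inr None).
Definition bit (b : bool) : sym := Some (inl b).
Definition box (c : cell) : sym := Some (inr (Some c)).

Definition is_wall (x : sym) : bool := if x is Some (inr None) then true else false.
Definition is_one (x : sym) : bool := if x is Some (inl b) then b else false.
Definition is_blank (x : sym) : bool := if x is None then true else false.

Definition marked (x : sym) : bool := if x is Some (inr (Some c)) then c.2 else false.

(** For the current row x and column y: [m] tells whether x is marked, [b] is the matrix entry, and
    [c] is the cell of y. *)
Definition push (m b : bool) (c : cell) : cell := (c.1, c.2 || [&& ~~ c.1, b & m]).

Definition action : Type := (sym * move)%type.
Definition go_left (a : sym) : action := (a, MoveLeft).
Definition keep (a : sym) : action := (a, Stay).
Definition go_right (a : sym) : action := (a, MoveRight).

Definition control_step (q : Q) (i x y : sym) : state * action * action * action :=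
  match x, y with
  | Some (inr (Some cx)), Some (inr (Some cy)) =>
    let: (q', c) := delta q cx cy in
    (Control q', keep i, go_right (box c), go_right (box c))
  | _, _ =>
    match verdict q with
    | inl b => (Halt b, keep i, keep x, keep y)
    | inr q' => (RewindCells q', keep i, go_left x, go_left y)
    end
  end.

(** Initialization enters [RewindNew] with the old head on its closing wall, as after the last row
    of a cycle, and thus shares the way back to [Control]. *)
Definition transition (s : state) (i x y : sym) : state * action * action * action :=
  match s with
  | Start => (CopyOrder, keep i, go_right wall, go_right wall)
  | CopyOrder =>
    if is_one i then
      (CopyOrder, go_right i, go_right (box (false, false)), go_right (box (false, false)))
    else (SkipMatrix, go_right wall, keep wall, keep wall)
  | SkipMatrix =>
    if is_blank i then (RewindNew q0, keep wall, keep x, go_left y)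
    else (SkipMatrix, go_right i, keep x, keep y)
  | Halt b => (Halt b, keep i, keep x, keep y)
  | RewindInput q =>
    if is_wall i then (RewindOld q, keep i, keep x, keep y)
    else (RewindInput q, go_left i, keep x, keep y)
  | RewindOld q =>
    if is_wall x then (Control q, keep i, go_right x, go_right y)
    else (RewindOld q, keep i, go_left x, keep y)
  | Control q => control_step q i x y
  | RewindCells q =>
    if is_wall y then (RowStart q, go_right i, go_right x, keep y)
    else (RewindCells q, keep i, go_left x, go_left y)
  | RowStart q =>
    if is_wall x then (RewindInput q, go_left i, go_left x, keep y)
    else (RowSweep q, keep i, keep x, go_right y)
  | RowSweep q =>
    if y is Some (inr (Some c)) then
      (RowSweep q, go_right i, keep x, go_right (box (push (marked x) (is_one i) c)))
    else (RewindNew q, keep i, go_right x, go_left y)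
  | RewindNew q =>
    if is_wall y then (RowStart q, keep i, keep x, keep y)
    else (RewindNew q, keep i, keep x, go_left y)
  end.

Definition pick3 (T : Type) (a b c : T) (i : 'I_3) : T :=
  match val i with 0 => a | 1 => b | _ => c end.

Definition sweeper : tm 2 := @TM 2 state work Start
  (fun s => if s is Halt b then Some b else None)
  (fun s f =>
     let: (s', ai, ax, ay) :=
       transition s (f (@Ordinal 3 0 isT)) (f (@Ordinal 3 1 isT)) (f (@Ordinal 3 2 isT)) in
     (s', [ffun i => pick3 ai ax ay i])).

Definition conf (s : state) (I X Y : tape work) : config sweeper :=
  (s, [ffun i => pick3 I X Y i]).

Lemma tm_step_conf s I X Y : tm_verdict (t := sweeper) s = None ->
  tm_step (conf s I X Y) =
  let: (s', ai, ax, ay) := transition s (tape_read I) (tape_read X) (tape_read Y) in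
  conf s' (tape_act I ai) (tape_act X ax) (tape_act Y ay).
Proof.
move=> /= sN; rewrite /tm_step /= sN !ffunE /pick3 /=.
case: transition => [[[s' ai] ax] ay]; congr pair.
by apply/ffunP => -[[|[|i]] lti]; rewrite !ffunE.
Qed.

(** * Step-bounded runs and the effect of one cycle *)

Definition runs (n : nat) (c c' : config sweeper) : Prop :=
  exists2 k, k <= n & iter k (@tm_step 2 sweeper) c = c'.

Lemma runs0 c : runs 0 c c.
Proof. by exists 0. Qed.

Lemma runs_trans n1 n2 c1 c2 c3 : runs n1 c1 c2 -> runs n2 c2 c3 -> runs (n1 + n2) c1 c3.
Proof.
move=> [k1 le1 <-] [k2 le2 <-]; exists (k2 + k1); last by rewrite iterD.
by rewrite addnC leq_add.
Qed.

Lemma runs_leq n1 n2 c c' : n1 <= n2 -> runs n1 c c' -> runs n2 c c'.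
Proof. by move=> le [k kle <-]; exists k => //; apply: leq_trans le. Qed.

Lemma runs1 c c' : tm_step c = c' -> runs 1 c c'.
Proof. by move=> <-; exists 1. Qed.

Lemma runsS n c c' : runs n (tm_step c) c' -> runs n.+1 c c'.
Proof. by move=> r; rewrite -add1n; apply: runs_trans (runs1 erefl) r. Qed.

(* The tape after a left move from the first cell of r, when its left part is *)
(* u ++ wall :: l in reverse order.                                           *)
Definition left_of (u l r : seq sym) : tape work :=
  (behead (u ++ wall :: l), head None (u ++ wall :: l) :: r).

Definition walled (cs : seq cell) : seq sym := wall :: map box cs ++ [:: wall].

(* On a tape whose right part is empty, writing back the blank just read      *)
(* changes the representation of the tape.                                    *)
Definition live (T : tape work) : bool := if T.2 is [::] then false else true.

Lemma tape_act_keep T : live T -> tape_act T (keep (tape_read T)) = T.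
Proof. by case: T => l [|a r]. Qed.

Lemma rewind_input q u l r X Y : live X -> live Y -> all (predC is_wall) u ->
  runs (size u).+1 (conf (RewindInput q) (left_of u l r) X Y)
                   (conf (RewindOld q) (l, wall :: catrev u r) X Y).
Proof.
move=> lX lY; elim: u r => [|a u IHu] r /=.
  by move=> _; apply: runs1; rewrite tm_step_conf //= !tape_act_keep.
case/andP=> /negbTE aN uN; apply: runsS; rewrite tm_step_conf //= aN.
by rewrite !tape_act_keep //; apply: IHu.
Qed.

Lemma rewind_old q I u r Yr : live I -> all (predC is_wall) u ->
  runs (size u).+1 (conf (RewindOld q) I (left_of u [::] r) ([::], wall :: Yr))
    (conf (Control q) I ([:: wall], catrev u r) ([:: wall], Yr)).
Proof.
move=> lI; elim: u r => [|a u IHu] r /=.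
  by move=> _; apply: runs1; rewrite tm_step_conf //= tape_act_keep.
case/andP=> /negbTE aN uN; apply: runsS; rewrite tm_step_conf //= aN.
by rewrite tape_act_keep //; apply: IHu.
Qed.

Lemma rewind_new q I X u r : live I -> live X -> all (predC is_wall) u ->
  runs (size u).+1 (conf (RewindNew q) I X (left_of u [::] r))
    (conf (RowStart q) I X ([::], wall :: catrev u r)).
Proof.
move=> lI lX; elim: u r => [|a u IHu] r /=.
  by move=> _; apply: runs1; rewrite tm_step_conf //= !tape_act_keep.
case/andP=> /negbTE aN uN; apply: runsS; rewrite tm_step_conf //= aN.
by rewrite !tape_act_keep //; apply: IHu.
Qed.

Lemma rewind_cells q l a i u r : all (predC is_wall) u ->
  runs (size u).+1
    (conf (RewindCells q) (l, a :: i) (left_of u [::] r) (left_of u [::] r))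
    (conf (RowStart q) (a :: l, i) ([:: wall], catrev u r) ([::], wall :: catrev u r)).
Proof.
elim: u r => [|b u IHu] r /=.
  by move=> _; apply: runs1; rewrite tm_step_conf.
case/andP=> /negbTE bN uN; apply: runsS; rewrite tm_step_conf //= bN.
exact: IHu.
Qed.

(** The sweep without tapes; one list is returned because the output overwrites both arrays. *)
Fixpoint control_pass (q : Q) (xs ys : seq cell) : Q * seq cell :=
  match xs, ys with
  | x :: xs', y :: ys' =>
    let: (q1, c) := delta q x y in
    let: (q2, cs) := control_pass q1 xs' ys' in (q2, c :: cs)
  | _, _ => (q, [::])
  end.

Lemma control_pass_size q xs ys : size xs = size ys ->
  size (control_pass q xs ys).2 = size ys.
Proof.
elim: xs ys q => [|x xs IHxs] [|y ys] q //= [eqs].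
case: (delta _ _ _) => q1 c; have := IHxs ys q1 eqs.
by case: (control_pass _ _ _) => q2 cs /= ->.
Qed.

Lemma control_loop q I l xs ys r : live I -> size xs = size ys ->
  let: (q', cs) := control_pass q xs ys in
  let T := (catrev (map box cs) l, r) in
  runs (size ys)
    (conf (Control q) I (l, map box xs ++ r) (l, map box ys ++ r))
    (conf (Control q') I T T).
Proof.
move=> lI; elim: xs ys q l => [|x xs IHxs] [|y ys] q l //= => [_|[eqs]].
  exact: runs0.
case E1: (delta _ _ _) => [q1 c]; have := IHxs ys q1 (box c :: l) eqs.
case: (control_pass _ _ _) => q2 cs /= run.
by apply: runsS; rewrite tm_step_conf //= E1 tape_act_keep.
Qed.

Fixpoint row_pass (m : bool) (bs : seq bool) (cs : seq cell) : seq cell :=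
  match bs, cs with
  | b :: bs', c :: cs' => push m b c :: row_pass m bs' cs'
  | _, _ => [::]
  end.

Lemma row_pass_size m bs cs : size bs = size cs -> size (row_pass m bs cs) = size cs.
Proof. by elim: bs cs => [|b bs IHbs] [|c cs] //= [/IHbs->]. Qed.

Lemma row_loop q li ri X l r bs cs : live X -> size bs = size cs ->
  runs (size cs)
    (conf (RowSweep q) (li, map bit bs ++ ri) X (l, map box cs ++ r))
    (conf (RowSweep q) (catrev (map bit bs) li, ri) X
       (catrev (map box (row_pass (marked (tape_read X)) bs cs)) l, r)).
Proof.
move=> lX; elim: bs cs li l => [|b bs IHbs] [|c cs] li l //= => [_|[eqs]].
  exact: runs0.
by apply: runsS; rewrite tm_step_conf //= tape_act_keep //; apply: IHbs.
Qed.

Lemma all_box cs : all (predC is_wall) (map box cs).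
Proof. by elim: cs. Qed.

Lemma all_bit bs : all (predC is_wall) (map bit bs).
Proof. by elim: bs. Qed.

Lemma catrev_rev (T : Type) (s t : seq T) : catrev (rev s) t = s ++ t.
Proof. by rewrite catrevE revK. Qed.

(** The new array is swept forth and back, while the input head moves on to the next row and the old
    head to the next vertex. Nonempty [ri] and [rx] keep these heads off the end of the tape
    representation. *)
Lemma row_run q li ri lx cx rx bs cs :
  size bs = size cs -> ri <> [::] -> rx <> [::] ->
  runs (2 * size cs + 3)
    (conf (RowStart q) (li, map bit bs ++ ri) (lx, box cx :: rx) ([::], walled cs))
    (conf (RowStart q) (catrev (map bit bs) li, ri) (box cx :: lx, rx)
       ([::], walled (row_pass cx.2 bs cs))).
Proof.
move=> eqs ri0 rx0; set cs' := row_pass _ _ _.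
have lI : live (li, map bit bs ++ ri) by case: (bs) ri0 => //=; case: (ri).
have lI' l : live (l, ri) by move: ri0; rewrite /live /=; case: (ri).
apply: (@runs_leq (1 + (size cs + (1 + (size cs).+1)))); first by lia.
have s1 I : live I ->
  runs 1 (conf (RowStart q) I (lx, box cx :: rx) ([::], walled cs))
    (conf (RowSweep q) I (lx, box cx :: rx) ([:: wall], map box cs ++ [:: wall])).
  by move=> ?; apply: runs1; rewrite tm_step_conf //= tape_act_keep.
have s2 I : live I ->
  runs 1 (conf (RowSweep q) I (lx, box cx :: rx)
            (catrev (map box cs') [:: wall], [:: wall]))
    (conf (RewindNew q) I (box cx :: lx, rx) (left_of (rev (map box cs')) [::] [:: wall])).
  by move=> ?; apply: runs1; rewrite tm_step_conf //= tape_act_keep // catrevE.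
apply: runs_trans (s1 _ lI) _; apply: runs_trans (row_loop _ _ _ _ _ _ eqs) _ => //=.
rewrite -/cs'; apply: runs_trans (s2 _ (lI' _)) _.
have := @rewind_new q (catrev (map bit bs) li, ri) (box cx :: lx, rx) (rev (map box cs')) [:: wall].
rewrite catrev_rev size_rev size_map row_pass_size // all_rev all_box.
by apply; [apply: lI' | case: (rx) rx0 |].
Qed.

(** The marks are read from the fixed [xs] while [ys] accumulates, so one cycle advances the closure
    by a single layer. *)
Fixpoint matrix_pass (xs : seq cell) (rows : seq (seq bool)) (ys : seq cell) : seq cell :=
  match xs, rows with
  | x :: xs', bs :: rows' => matrix_pass xs' rows' (row_pass x.2 bs ys)
  | _, _ => ys
  end.

Lemma matrix_run q li ri lx xs rx rows ys :
  size rows = size xs -> all (fun bs => size bs == size ys) rows ->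
  ri <> [::] -> rx <> [::] ->
  runs (size xs * (2 * size ys + 3))
    (conf (RowStart q) (li, map bit (flatten rows) ++ ri) (lx, map box xs ++ rx)
       ([::], walled ys))
    (conf (RowStart q) (catrev (map bit (flatten rows)) li, ri)
       (catrev (map box xs) lx, rx) ([::], walled (matrix_pass xs rows ys))).
Proof.
move=> + + ri0 rx0.
elim: xs rows ys li lx => [|x xs IHxs] [|bs rows] ys li lx //= => [_ _|[eqs]].
  exact: runs0.
case/andP=> /eqP eqb eqr; rewrite mulSn map_cat -catA.
have run1 := @row_run q li (map bit (flatten rows) ++ ri) lx x (map box xs ++ rx) bs ys eqb.
apply: (runs_trans (run1 _ _)).
- by case: (map bit _).
- by case: (map box _).
by rewrite -{1}(row_pass_size x.2 eqb) catrev_catl; apply: IHxs; rewrite ?row_pass_size.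
Qed.

Definition control_start q bs xs ys : config sweeper :=
  conf (Control q) (nseq (size xs) (bit true), wall :: map bit bs ++ [:: wall])
    ([:: wall], map box xs ++ [:: wall]) ([:: wall], map box ys ++ [:: wall]).

Lemma return_run q bs xs ys :
  runs (size bs + size xs + 3)
    (conf (RowStart q)
      (catrev (map bit bs) (wall :: nseq (size xs) (bit true)), [:: wall])
      (catrev (map box xs) [:: wall], [:: wall]) ([::], walled ys))
    (control_start q bs xs ys).
Proof.
apply: (@runs_leq (1 + ((size bs).+1 + (size xs).+1))); first by lia.
have s1 : runs 1 (conf (RowStart q)
      (catrev (map bit bs) (wall :: nseq (size xs) (bit true)), [:: wall])
      (catrev (map box xs) [:: wall], [:: wall]) ([::], walled ys))
    (conf (RewindInput q)
      (left_of (rev (map bit bs)) (nseq (size xs) (bit true)) [:: wall])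
      (left_of (rev (map box xs)) [::] [:: wall]) ([::], walled ys)).
  by apply: runs1; rewrite tm_step_conf //= !catrevE.
apply: runs_trans s1 _.
have sI := @rewind_input q (rev (map bit bs)) (nseq (size xs) (bit true)) [:: wall]
  (left_of (rev (map box xs)) [::] [:: wall]) ([::], walled ys).
rewrite size_rev size_map all_rev all_bit catrev_rev in sI.
apply: runs_trans (sI _ _ _) _ => //.
have sX := @rewind_old q (nseq (size xs) (bit true), wall :: map bit bs ++ [:: wall])
  (rev (map box xs)) [:: wall] (map box ys ++ [:: wall]).
by rewrite size_rev size_map all_rev all_box catrev_rev in sX; apply: sX.
Qed.

(** A generous bound: a full cycle takes at most 3n^2 + 6n + 5 steps, mostly row sweeps and the way
    back over the matrix. *)
Definition cycle_time (n : nat) : nat := 10 * n.+1 * n.+1.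

Lemma cycle_run q xs ys rows n :
  size xs = n -> size ys = n -> size rows = n -> all (fun bs => size bs == n) rows ->
  let: (q1, cs) := control_pass q xs ys in
  match verdict q1 with
  | inl b => exists2 c, runs (cycle_time n) (control_start q (flatten rows) xs ys) c
                        & tm_verdict c.1 = Some b
  | inr q2 => runs (cycle_time n) (control_start q (flatten rows) xs ys)
                (control_start q2 (flatten rows) cs (matrix_pass cs rows cs))
  end.
Proof.
move=> sx sy sr ar; have sxy : size xs = size ys by rewrite sy.
have sfl : size (flatten rows) = n * n by rewrite (size_flatten_const ar) sr.
set I := (nseq (size xs) (bit true), wall :: map bit (flatten rows) ++ [:: wall]).
have := @control_loop q I [:: wall] xs ys [:: wall] isT sxy.
have := control_pass_size q sxy.
case: (control_pass _ _ _) => q1 cs /= scs run1.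
set T := (catrev _ _, _) in run1.
case E: (verdict q1) => [b|q2].
  exists (conf (Halt b) I T T) => //.
  apply: (@runs_leq (size ys + 1)); first by rewrite sy /cycle_time; lia.
  by apply: runs_trans run1 _; apply: runs1; rewrite tm_step_conf //= E.
apply: (@runs_leq (size ys + (1 + ((size cs).+1 + (size cs * (2 * size cs + 3) +
  (size (flatten rows) + size cs + 3)))))).
  by rewrite scs sy sfl /cycle_time; lia.
apply: runs_trans run1 _.
have s2 : runs 1 (conf (Control q1) I T T)
  (conf (RewindCells q2) I (left_of (rev (map box cs)) [::] [:: wall])
     (left_of (rev (map box cs)) [::] [:: wall])).
  by apply: runs1; rewrite tm_step_conf //= E /T !catrevE.
apply: runs_trans s2 _.
have s3 := @rewind_cells q2 (nseq (size xs) (bit true)) wall (map bit (flatten rows) ++ [:: wall])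
  (rev (map box cs)) [:: wall].
rewrite size_rev size_map all_rev all_box catrev_rev in s3.
apply: runs_trans (s3 isT) _.
have scn : size cs = n by rewrite scs.
have s4 := @matrix_run q2 (wall :: nseq (size xs) (bit true)) [:: wall] [:: wall] cs [:: wall] rows cs.
apply: runs_trans (s4 _ _ _ _) _ => //; rewrite ?scn //.
rewrite sx -scn; exact: return_run.
Qed.

Lemma copy_order_loop n li ri l : 
  runs n (conf CopyOrder (li, nseq n (bit true) ++ ri) (l, [::]) (l, [::]))
    (conf CopyOrder (catrev (nseq n (bit true)) li, ri)
       (catrev (nseq n (box (false, false))) l, [::])
       (catrev (nseq n (box (false, false))) l, [::])).
Proof.
elim: n li l => [|n IHn] li l; first exact: runs0.
by apply: runsS; rewrite tm_step_conf //=; apply: IHn.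
Qed.

Lemma skip_matrix_loop bs li X Y : live X -> live Y ->
  runs (size bs) (conf SkipMatrix (li, map bit bs) X Y)
    (conf SkipMatrix (catrev (map bit bs) li, [::]) X Y).
Proof.
move=> lX lY; elim: bs li => [|b bs IHbs] li; first exact: runs0.
by apply: runsS; rewrite tm_step_conf //= !tape_act_keep //; apply: IHbs.
Qed.

Lemma init_run n bs :
  runs (2 * n + 2 * size bs + n + 10)
    (tm_init sweeper (nseq n true ++ false :: bs))
    (control_start q0 bs (nseq n (false, false)) (nseq n (false, false))).
Proof.
have -> : tm_init sweeper (nseq n true ++ false :: bs) =
  conf Start ([::], nseq n (bit true) ++ bit false :: map bit bs) ([::], [::]) ([::], [::]).
  congr pair; apply/ffunP => -[[|[|i]] lti]; rewrite !ffunE //=.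
  by rewrite map_cat /= map_nseq.
apply: (@runs_leq (1 + (n + (1 + (size bs + (1 + (n.+1 + (size bs + n + 3)))))))); first by lia.
set blank := nseq n (box (false, false)).
have blankE : blank = map box (nseq n (false, false)) by rewrite map_nseq.
have s1 I : live I -> runs 1 (conf Start I ([::], [::]) ([::], [::]))
  (conf CopyOrder I ([:: wall], [::]) ([:: wall], [::])).
  by move=> ?; apply: runs1; rewrite tm_step_conf //= tape_act_keep.
apply: (runs_trans (s1 _ _)); first by case: (n).
apply: runs_trans (copy_order_loop _ _ _ _) _; rewrite -/blank.
set T := (catrev blank [:: wall], [:: wall]).
have s2 : runs 1 (conf CopyOrder (catrev (nseq n (bit true)) [::], bit false :: map bit bs)
     (catrev blank [:: wall], [::]) (catrev blank [:: wall], [::]))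
  (conf SkipMatrix (wall :: nseq n (bit true), map bit bs) T T).
  apply: runs1; rewrite tm_step_conf //=; congr (conf _ (_ :: _, _) _ _).
  by rewrite catrevE cats0 rev_nseq.
apply: runs_trans s2 _; apply: runs_trans (skip_matrix_loop _ _ _ _) _ => //.
set I := (catrev (map bit bs) (wall :: nseq n (bit true)), [:: wall]).
have s3 : runs 1 (conf SkipMatrix (catrev (map bit bs) (wall :: nseq n (bit true)), [::]) T T)
  (conf (RewindNew q0) I T (left_of (rev blank) [::] [:: wall])).
  by apply: runs1; rewrite tm_step_conf //= /I /T /left_of !catrevE.
apply: runs_trans s3 _.
have s4 := @rewind_new q0 I T (rev blank) [:: wall] isT isT.
have sb : size blank = n by apply: size_nseq.
rewrite size_rev sb all_rev catrev_rev {1}blankE all_box in s4.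
apply: runs_trans (s4 isT) _.
have := return_run q0 bs (nseq n (false, false)) (nseq n (false, false)).
by rewrite !size_nseq /T blankE.
Qed.

Lemma iter_halted k (c : config sweeper) b : tm_verdict c.1 = Some b ->
  iter k (@tm_step 2 sweeper) c = c.
Proof.
move=> cb; elim: k => //= k ->; rewrite /tm_step; case: c cb => q tps /= cb.
by rewrite cb.
Qed.

Lemma tm_run_runs w T s c b : runs T (tm_init sweeper w) c ->
  tm_verdict c.1 = Some b -> T <= s -> tm_run sweeper w s = Some b.
Proof.
move=> [k kT <-] cb Ts; rewrite /tm_run -(subnK (leq_trans kT Ts)) iterD.
by rewrite (iter_halted _ cb).
Qed.

(** The first argument of [inv] is a variant: it decreases with every cycle that does not halt, so
    at most m + 1 cycles occur. *)
Lemma cycles_run n rows b (inv : nat -> Q -> seq cell -> seq cell -> Prop) :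
  size rows = n -> all (fun bs => size bs == n) rows ->
  (forall m q xs ys, inv m q xs ys ->
    [/\ size xs = n, size ys = n &
     let: (q1, cs) := control_pass q xs ys in
     match verdict q1 with
     | inl b' => b' = b
     | inr q2 => exists2 m', m' < m & inv m' q2 cs (matrix_pass cs rows cs)
     end]) ->
  forall m q xs ys, inv m q xs ys ->
  exists2 c, runs (m.+1 * cycle_time n) (control_start q (flatten rows) xs ys) c
             & tm_verdict c.1 = Some b.
Proof.
move=> sr ar step m; elim/ltn_ind: m => m IHm q xs ys /step[sx sy].
have := cycle_run q sx sy sr ar.
case: (control_pass _ _ _) => q1 cs; case: (verdict q1) => [b'|q2].
  move=> [c run cb] <-; exists c => //; apply: runs_leq run.
  by rewrite mulSn leq_addr.
move=> run [m' m'm /(IHm _ m'm)[c run' cb]]; exists c => //.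
apply: runs_leq (runs_trans run run').
by rewrite -mulSn leq_mul2r ltnS m'm orbT.
Qed.

End SweepingMachine.

(** * Enumerating the words of bounded weight *)

(* The least significant bit comes first. Carry adds 1 to the word; Skip adds *)
(* its lowest set bit, which passes over the words obtained from it by        *)
(* setting lower bits, that is, over words of larger weight.                  *)
Inductive carry := Skip | Carry | Copy.

Definition next_bit (z : carry) (b : bool) : carry * bool :=
  match z, b with
  | Skip, false => (Skip, false)
  | Skip, true => (Carry, false)
  | Carry, true => (Carry, false)
  | Carry, false => (Copy, true)
  | Copy, _ => (Copy, b)
  end.

Fixpoint next (z : carry) (w : seq bool) : carry * seq bool :=
  if w is b :: w' then
    let: (z1, b1) := next_bit z b in
    let: (z2, w2) := next z1 w' in (z2, b1 :: w2)
  else (z, [::]).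

(** On words of equal length, the order of binary numbers whose last bit is the most significant. *)
Fixpoint colex (u v : seq bool) : bool :=
  match u, v with
  | a :: u', b :: v' => colex u' v' || [&& u' == v', ~~ a & b]
  | _, _ => false
  end.

Lemma colex_irr u : colex u u = false.
Proof. by elim: u => //= a u ->; case: a; rewrite /= ?andbF. Qed.

Lemma colex_trans v u w : colex u v -> colex v w -> colex u w.
Proof.
elim: v u w => [|b v IHv] [|a u] [|c w] //=.
case/orP=> [uv|/and3P[/eqP-> na b1]] /orP[vw|/and3P[/eqP<- nb c1]].
- by rewrite (IHv _ _ uv vw).
- by rewrite uv.
- by rewrite vw.
- by rewrite b1 in nb.
Qed.

Lemma colex_nseq u : u = nseq (size u) false \/ colex (nseq (size u) false) u.
Proof.
elim: u => [|b u [IHu|IHu]] /=; [by left| |by right; rewrite IHu].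
by case: b; [right; rewrite [_ == u]eq_sym [u == _](introT eqP IHu) orbT | left; congr cons].
Qed.

Lemma next_size z w : size (next z w).2 = size w.
Proof.
elim: w z => //= b w IHw z; case: (next_bit z b) => z1 b1.
by have := IHw z1; case: (next z1 w) => z2 w2 /= ->.
Qed.

Lemma next_copy w : next Copy w = (Copy, w).
Proof. by elim: w => //= b w ->. Qed.

(** Ending in [Copy] means that the addition did not overflow. *)
Lemma next_gt z w : z <> Copy -> (next z w).1 = Copy -> colex w (next z w).2.
Proof.
elim: w z => [|b w IHw] z //= zC.
have [IHs IHc] := (IHw Skip, IHw Carry).
case: z b zC => [] [] //= _; rewrite ?next_copy /= ?eqxx ?orbT //.
- by case: (next Carry w) IHc => z2 w2 /= IH E; rewrite IH.
- by case: (next Skip w) IHs => z2 w2 /= IH E; rewrite IH.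
- by case: (next Carry w) IHc => z2 w2 /= IH E; rewrite IH.
Qed.

Lemma next_carry_least w u : size u = size w -> colex w u ->
  (next Carry w).1 = Copy /\ ((next Carry w).2 = u \/ colex (next Carry w).2 u).
Proof.
elim: w u => [|a w IHw] [|b u] //= [eqs].
case: a => /=.
  rewrite andbF orbF => /(IHw _ eqs); case: (next Carry w) => z2 w2 /= [-> le].
  split=> //; case: le => [->|lt]; last by right; rewrite lt.
  by case: b; [right; rewrite eqxx orbT | left].
rewrite next_copy /= => /orP[lt|/andP[/eqP<- ->]]; split=> //; last by left.
by right; rewrite lt.
Qed.

(** The words passed over arise from w by setting zeros below its lowest one, so they are heavier
    than w and cannot be u. *)
Lemma next_skip_least w u : size u = size w -> count_mem true u <= count_mem true w ->
  colex w u ->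
  (next Skip w).1 = Copy /\ ((next Skip w).2 = u \/ colex (next Skip w).2 u).
Proof.
elim: w u => [|a w IHw] [|b u] //= [eqs].
case: a => /= [_|le].
  rewrite andbF orbF => /(next_carry_least eqs); case: (next Carry w) => z2 w2 /= [-> le].
  split=> //; case: le => [->|lt]; last by right; rewrite lt.
  by case: b; [right; rewrite eqxx orbT | left].
case/orP=> [lt|/andP[/eqP wu b1]]; last by move: le; rewrite wu b1 /= add0n add1n ltnn.
have /(IHw _ eqs) : count_mem true u <= count_mem true w by apply: leq_trans le; apply: leq_addl.
case: (next Skip w) => z2 w2 /= /(_ lt)[-> le']; split=> //.
case: le' => [->|lt']; last by right; rewrite lt'.
by case: (b); [right; rewrite eqxx orbT | left].
Qed.

Lemma next_carry_weight w : count_mem true (next Carry w).2 <= (count_mem true w).+1.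
Proof.
elim: w => //= -[] w; rewrite ?next_copy //=.
case: (next Carry w) => z2 w2 /=; lia.
Qed.

(** Clearing the lowest one pays for the bit that the carry may set. *)
Lemma next_skip_weight w : count_mem true (next Skip w).2 <= count_mem true w.
Proof.
elim: w => //= -[] w /=; last by case: (next Skip w) => z2 w2 /=; lia.
by have := next_carry_weight w; case: (next Carry w) => z2 w2 /=; lia.
Qed.

(** * Checking all small cuts *)

(* Check tests whether the last cycle marked a new vertex. If not, the marked *)
(* set is a union of components of G - S, and Seed marks one more vertex;     *)
(* c counts the seeds, hence the components, up to the cap C, and s counts S. *)
(* If no vertex is left, Next moves to the next set S of size at most K.      *)
Section CutChecker.

Variables (K C : nat) (viol : nat -> nat -> bool).

Inductive phase :=
  | Check of 'I_C.+1 & bool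
  | Seed of 'I_C.+1 & 'I_K.+1 & bool
  | Next of carry.

Definition phase_code (q : phase) : ('I_C.+1 * bool) + ('I_C.+1 * 'I_K.+1 * bool) + 'I_3 :=
  match q with
  | Check c b => inl (inl (c, b))
  | Seed c s b => inl (inr (c, s, b))
  | Next Skip => inr (@Ordinal 3 0 isT)
  | Next Carry => inr (@Ordinal 3 1 isT)
  | Next Copy => inr (@Ordinal 3 2 isT)
  end.

Definition phase_decode (x : ('I_C.+1 * bool) + ('I_C.+1 * 'I_K.+1 * bool) + 'I_3) : phase :=
  match x with
  | inl (inl (c, b)) => Check c b
  | inl (inr (c, s, b)) => Seed c s b
  | inr i => Next (nth Skip [:: Skip; Carry; Copy] i)
  end.

Lemma phase_codeK : cancel phase_code phase_decode.
Proof. by case=> // -[]. Qed.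

HB.instance Definition _ := Finite.copy phase (can_type phase_codeK).

Definition phase_step (q : phase) (x y : cell) : phase * cell :=
  match q with
  | Check c b => (Check c (b || (x.2 != y.2)), y)
  | Seed c s b =>
    let fresh := [&& ~~ b, ~~ y.1 & ~~ y.2] in
    (Seed c (inord (minn K (s + y.1))) (b || fresh), (y.1, y.2 || fresh))
  | Next z => let: (z', b) := next_bit z y.1 in (Next z', (b, false))
  end.

(** [Seed] without a fresh vertex means that G - S is exhausted and c is its capped component count.
    [Next] not ending in [Copy] means overflow: every small set has passed. *)
Definition phase_end (q : phase) : bool + phase :=
  match q with
  | Check c true => inr (Check c false)
  | Check c false => inr (Seed c ord0 false)
  | Seed c s true => inr (Check (inord (minn C c.+1)) false)
  | Seed c s false =>
    if viol s c then inl false else inr (Next (if s < K then Carry else Skip))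
  | Next Copy => inr (Seed ord0 ord0 false)
  | Next _ => inl true
  end.

Local Notation pass := (control_pass phase_step).

(** * The passes as operations on vertex sets *)

Section Passes.

Variable T : eqType.
Implicit Types (S M X : pred T) (E : seq T).

Definition cell_of S M v : cell := (S v, M v).

Lemma check_pass c b S S' X M E :
  pass (Check c b) (map (cell_of S' X) E) (map (cell_of S M) E) =
  (Check c (b || has (fun v => X v != M v) E), map (cell_of S M) E).
Proof. by elim: E b => [|v E IHE] b /=; rewrite ?orbF // IHE orbA. Qed.

Lemma next_pass z S M xs E : size xs = size E ->
  pass (Next z) xs (map (cell_of S M) E) =
  let: (z', u) := next z (map S E) in (Next z', [seq (b, false) | b <- u]).
Proof.
elim: E xs z => [|v E IHE] [|x xs] z //= [eqs].
case: (next_bit z (S v)) => z1 b1; rewrite IHE //.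
by case: (next z1 _) => z2 w2.
Qed.

Lemma sat_add (s : 'I_K.+1) (b : bool) :
  val (inord (minn K (s + b)) : 'I_K.+1) = minn K (s + b).
Proof. by rewrite /= inordK // ltnS geq_minl. Qed.

Lemma seeded_pass c (s : 'I_K.+1) S M (xs : seq cell) E : size xs = size E ->
  exists2 s' : 'I_K.+1, val s' = minn K (s + count S E) &
  pass (Seed c s true) xs (map (cell_of S M) E) = (Seed c s' true, map (cell_of S M) E).
Proof.
elim: E xs s => [|v E IHE] [|x xs] s //= => [_|[eqs]].
  by exists s => //; rewrite addn0; apply/esym/minn_idPr; rewrite -ltnS.
have [s' s'E ->] := IHE xs (inord (minn K (s + S v))) eqs.
exists s'; first by rewrite s'E sat_add; lia.
by rewrite orbF.
Qed.

Lemma seed_pass c (s : 'I_K.+1) S M (xs : seq cell) E : size xs = size E -> uniq E ->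
  exists2 s' : 'I_K.+1, val s' = minn K (s + count S E) &
  pass (Seed c s false) xs (map (cell_of S M) E) =
  match [seq v <- E | ~~ S v && ~~ M v] with
  | [::] => (Seed c s' false, map (cell_of S M) E)
  | v :: _ => (Seed c s' true, map (cell_of S (predU1 v M)) E)
  end.
Proof.
elim: E xs s => [|v E IHE] [|x xs] s //= => [_ _|[eqs] /andP[vE uE]].
  by exists s => //; rewrite addn0; apply/esym/minn_idPr; rewrite -ltnS.
have sE s' : minn K ((inord (minn K (s + S v)) : 'I_K.+1) + s') = minn K (s + (S v + s')).
  by rewrite sat_add; lia.
case: ifP => fr.
  have [s' s'E passE] := seeded_pass c (inord (minn K (s + S v))) S M eqs.
  exists s'; first by rewrite s'E sE.
  rewrite passE orbT /=; congr (_, _ :: _); first by rewrite /cell_of /= eqxx.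
  apply/eq_in_map => w wE; rewrite /cell_of /=.
  by have /negbTE-> : w != v by apply: contraNneq vE => <-.
have [s' s'E passE] := IHE xs (inord (minn K (s + S v))) eqs uE.
exists s'; first by rewrite s'E sE.
rewrite passE orbF; case D: [seq _ <- E | _] => [|w D'] //.
congr (_, _ :: _); rewrite /cell_of /=.
have wE : w \in E by have := mem_head w D'; rewrite -D mem_filter => /andP[].
by have /negbTE-> : v != w by apply: contraNneq vE => ->.
Qed.

Lemma row_pass_cells m (a : T -> bool) S M E :
  row_pass m (map a E) (map (cell_of S M) E) =
  map (cell_of S (fun y => M y || [&& ~~ S y, a y & m])) E.
Proof. by elim: E => //= v E ->. Qed.

Lemma matrix_pass_cells (r : rel T) S S' X M E E' :
  matrix_pass (map (cell_of S' X) E') [seq [seq r x y | y <- E] | x <- E']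
    (map (cell_of S M) E) =
  map (cell_of S (fun y => M y || ~~ S y && has (fun x => X x && r x y) E')) E.
Proof.
elim: E' M => [|x E' IHE] M /=.
  by apply: eq_map => y; rewrite /cell_of andbF orbF.
rewrite row_pass_cells IHE; apply: eq_map => y; rewrite /cell_of.
by case: (M y) (S y) (X x) (r x y) => [] [] [] [].
Qed.

End Passes.

(** * Correctness and running time of the cut checker *)

Section OnGraph.

Variable G : graph.
Local Notation V := 'I_(Defs.order G).
Implicit Types (S M J T : {set V}).

Hypothesis violC : forall s c, s <= K -> viol s (minn C c) = viol s c.

Definition cells S M : seq cell :=
  map (cell_of (fun v => v \in S) (fun v => v \in M)) (enum V).

Definition word S : seq bool := [seq v \in S | v <- enum V].

Definition adj_rows : seq (seq bool) :=
  [seq [seq adj x y | y <- enum V] | x <- enum V].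

Definition grow S M := M :|: [set y in ~: S | [exists x in M, adj x y]].

Lemma size_cells S M : size (cells S M) = Defs.order G.
Proof. by rewrite size_map size_enum_ord. Qed.

Lemma size_word S : size (word S) = Defs.order G.
Proof. by rewrite size_map size_enum_ord. Qed.

Lemma word_weight S : count_mem true (word S) = #|S|.
Proof.
rewrite count_map cardE size_filter -enumT; apply: eq_count => v /=.
by rewrite eqb_id.
Qed.

Lemma word_inj : injective word.
Proof.
move=> S T /eq_in_map eqw; apply/setP => v.
by apply: eqw; rewrite mem_enum.
Qed.

Lemma word_surj u : size u = Defs.order G -> exists S, word S = u.
Proof.
move=> su; exists [set v : V | nth false u v].
apply: (@eq_from_nth _ false) => [|i]; rewrite size_word // => ltin.
rewrite (nth_map (Ordinal ltin)) ?size_enum_ord // inE.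
by rewrite nth_enum_ord.
Qed.

Lemma matrix_pass_grow S M :
  matrix_pass (cells S M) adj_rows (cells S M) = cells S (grow S M).
Proof.
rewrite matrix_pass_cells; apply: eq_map => y; rewrite /cell_of /grow !inE.
congr (_, _ || (_ && _)); apply/hasP/existsP => [[x _ /andP[xM axy]]|[x /andP[xM axy]]].
  by exists x; rewrite xM.
by exists x; rewrite ?mem_enum // xM.
Qed.

Lemma grow_sub S M : M \subset grow S M.
Proof. exact: subsetUl. Qed.

(** J is a system of representatives of the components of G - S that M meets. It lives in the proof
    only; the machine stores just min(C, |J|). *)
Definition seeds_ok S M J : Prop :=
  [/\ J \subset M, M \subset ~: S,
      (forall v, v \in M -> exists2 j, j \in J & connect (adj_minus S) j v) &
      {in J &, forall i j, connect (adj_minus S) i j -> i = j}].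

Lemma seeds_ok_grow S M J : seeds_ok S M J -> seeds_ok S (grow S M) J.
Proof.
case=> JM MS reach indep; split=> //.
- exact: subset_trans JM (grow_sub _ _).
- by rewrite subUset MS; apply/subsetP => y; rewrite !inE => /andP[].
move=> v /setUP[/reach//|]; rewrite !inE => /andP[vS /existsP[x /andP[xM axv]]].
have [j jJ jx] := reach x xM; exists j => //; apply: connect_trans jx (connect1 _).
by have := subsetP MS x xM; rewrite /adj_minus /= inE vS axv => ->.
Qed.

Lemma grow_fixed_connect S M u v : M \subset ~: S -> grow S M = M -> u \in M ->
  connect (adj_minus S) u v -> v \in M.
Proof.
move=> MS fixM uM /(closed_connect (a := mem M)) <- //.
apply: intro_closed; first exact: adj_minus_csym.
move=> x y /= /and3P[xS yS axy] xM; rewrite -fixM !inE yS /=.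
by apply/orP; right; apply/existsP; exists x; rewrite axy andbT.
Qed.

(** A set M fixed by [grow] is a union of components, so v lies in a new one. *)
Lemma seeds_ok_add S M J v : seeds_ok S M J -> grow S M = M ->
  v \notin S -> v \notin M -> seeds_ok S (v |: M) (v |: J).
Proof.
case=> JM MS reach indep fixM vS vM; split.
- exact: setUS.
- by rewrite subUset MS sub1set inE vS.
- move=> w /setU1P[->|/reach[j jJ jw]]; first by exists v; rewrite ?setU11 ?connect0.
  by exists j; rewrite // setU1r.
have far j : j \in J -> ~~ connect (adj_minus S) j v.
  move=> jJ; apply: contra vM => jv.
  exact: grow_fixed_connect MS fixM (subsetP JM _ jJ) jv.
move=> i j /setU1P[->|iJ] /setU1P[->|jJ] //.
- by rewrite adj_minus_csym => jv; case/negP: (far _ jJ).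
- by move=> iv; case/negP: (far _ iJ).
exact: indep.
Qed.

Lemma omega_seeds S J : seeds_ok S (~: S) J -> omega_minus S = #|J|.
Proof.
case=> JS _ reach indep; rewrite omega_minusE; apply/eqP; rewrite eqn_leq; apply/andP; split.
  pose f r := odflt r [pick j in J | connect (adj_minus S) j r].
  have fP r : r \in comp_roots S -> f r \in J /\ connect (adj_minus S) (f r) r.
    rewrite inE => /andP[/reach[j jJ jr] _]; rewrite /f.
    by case: pickP => [k /andP[]//|/(_ j)]; rewrite jJ jr.
  apply: (@leq_card_inj_in _ _ f) => [r /fP[]//|r1 r2 r1R r2R fE].
  have [_ c1] := fP _ r1R; have [_] := fP _ r2R; rewrite -fE => c2.
  apply: comp_roots_inj r1R r2R _; apply: connect_trans c2.
  by rewrite adj_minus_csym.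
apply: (@leq_card_inj_in _ _ (fingraph.root (adj_minus S))) => [j jJ|i j iJ jJ /eqP].
  by apply: comp_roots_root; have := subsetP JS _ jJ; rewrite inE.
by rewrite root_connect; [apply: indep | apply: adj_minus_csym].
Qed.

(** The number of small sets still to be visited, the leading term of the variant. *)
Definition later S : nat :=
  #|[set T : {set V} | (#|T| <= K) && colex (word S) (word T)]|.

Lemma later_lt S T : #|T| <= K -> colex (word S) (word T) -> later T < later S.
Proof.
move=> TK ST; apply/proper_card/properP; split.
  apply/subsetP => U; rewrite !inE => /andP[-> /(colex_trans ST)].
  by [].
by exists T; rewrite !inE TK ?ST //= colex_irr.
Qed.

Definition width : nat := 2 * Defs.order G + 2.

(* m bounds the number of remaining cycles. For each set S there are at most  *)
(* two cycles (Seed, Check) per newly marked vertex, hence the width.         *)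
Definition invariant (m : nat) (q : phase) (xs ys : seq cell) : Prop :=
  exists S M,
  [/\ xs = cells S M, ys = cells S (grow S M), #|S| <= K,
      (forall T, #|T| <= K -> viol #|T| (omega_minus T) ->
        T = S \/ colex (word S) (word T)) &
      match q with
      | Check c b => b = false /\ exists2 J, seeds_ok S M J &
          val c = minn C #|J| /\
          m = later S * width + 2 * (Defs.order G - #|M|) + 3
      | Seed c s b => [/\ b = false, s = ord0, grow S M = M &
          exists2 J, seeds_ok S M J &
          val c = minn C #|J| /\
          m = later S * width + 2 * (Defs.order G - #|M|) + 2]
      | Next z => [/\ z = (if #|S| < K then Carry else Skip),
          ~~ viol #|S| (omega_minus S) & m = later S * width + 1]
      end].

Definition small_cuts_ok : bool :=
  [forall T : {set V}, (#|T| <= K) ==> ~~ viol #|T| (omega_minus T)].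

(** The offsets 3, 2, 1 make [Check], [Seed], [Next] decrease in this order for a fixed M, and each
    newly marked vertex frees 2. Moving to the next set lowers [later] by at least one, which frees
    [width], the full budget of that set. *)
Lemma invariant_step m q xs ys : invariant m q xs ys ->
  [/\ size xs = Defs.order G, size ys = Defs.order G &
   let: (q1, cs) := pass q xs ys in
   match phase_end q1 with
   | inl b => b = small_cuts_ok
   | inr q2 => exists2 m', m' < m & invariant m' q2 cs (matrix_pass cs adj_rows cs)
   end].
Proof.
case=> S [M [-> -> SK least inv]]; rewrite !size_cells; split=> //.
have eqs : size (cells S M) = size (enum V) by rewrite size_cells size_enum_ord.
case: q inv => [c b|c s b|z].
- case=> -> [J ok [cE ->]]; rewrite check_pass /=.
  have JM := seeds_ok_grow ok.
  case: ifP => [/hasP[v _ neq]|/hasPn nohas].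
    have lt : #|M| < #|grow S M|.
      apply/proper_card; rewrite properEneq grow_sub andbT.
      by apply: contraNneq neq => <-.
    have le := max_card (mem (grow S M)); rewrite card_ord in le.
    exists (later S * width + 2 * (Defs.order G - #|grow S M|) + 3).
      by move: lt le; move: #|M| #|grow S M| (later S * width) => k1 k2 w; lia.
    exists S, (grow S M); split=> //; first by rewrite matrix_pass_grow.
    by split=> //; exists J.
  have fixM : grow S M = M.
    by apply/setP => v; have := nohas v; rewrite mem_enum negbK => /(_ isT)/eqP.
  exists (later S * width + 2 * (Defs.order G - #|M|) + 2).
    by rewrite ltn_add2l.
  exists S, M; rewrite fixM matrix_pass_grow fixM; split=> //.
  by split=> //; exists J.
- case=> -> -> fixM [J ok [cE ->]]; rewrite fixM.
  have [s' s'E ->] := seed_pass c ord0 (fun v => v \in S) (fun v => v \in M) eqs (enum_uniq _).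
  case D: [seq _ <- _ | _] => [|v D'] /=.
    have Mfull : M = ~: S.
      have [_ MS _ _] := ok; apply/eqP; rewrite eqEsubset MS /=.
      apply/subsetP => v; rewrite inE => vS; apply/negPn/negP => vM.
      have : v \in [seq v <- enum V | (v \notin S) && (v \notin M)].
        by rewrite mem_filter vS vM mem_enum.
      by rewrite D.
    have sE : val s' = #|S|.
      rewrite s'E add0n -[LHS]/(minn K (count (mem S) (enum V))) -size_filter.
      by rewrite enumT -[filter _ _]/(enum (mem S)) -cardE; apply/minn_idPr.
    have okS : seeds_ok S (~: S) J by rewrite -Mfull.
    (* The counter s is exact because |S| <= K; c is capped, which [violC] makes harmless. *)
    rewrite [nat_of_ord s']sE [nat_of_ord c]cE violC // -(omega_seeds okS).
    case: ifP => [bad|good].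
      by apply/esym/forallP => /(_ S); rewrite SK bad.
    exists (later S * width + 1); first by rewrite -addnA ltn_add2l addn2.
    by exists S, M; rewrite -/(cells S M) matrix_pass_grow; split=> //; split=> //; rewrite good.
  have /andP[vS vM] : (v \notin S) && (v \notin M).
    by have := mem_head v D'; rewrite -D mem_filter => /andP[].
  have -> : map (cell_of (fun v => v \in S) (predU1 v (fun v => v \in M))) (enum V) = cells S (v |: M).
    by apply: eq_map => w; rewrite /cell_of /= in_setU1.
  have le := max_card (mem (v |: M)); rewrite card_ord cardsU1 vM add1n in le.
  exists (later S * width + 2 * (Defs.order G - #|v |: M|) + 3).
    by rewrite cardsU1 vM add1n; move: le; move: #|M| (later S * width) => a w; lia.
  exists S, (v |: M); rewrite matrix_pass_grow; split=> //; split=> //.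
  have vJ : v \notin J by have [/subsetP JM _ _ _] := ok; apply: contra vM => /JM.
  exists (v |: J); first exact: seeds_ok_add.
  split=> //; rewrite /= inordK ?ltnS ?geq_minl // [nat_of_ord c]cE cardsU1 vJ add1n.
  by move: #|J| => a; lia.
case=> zE good ->; rewrite next_pass // -/(word S).
case E: (next z (word S)) => [z' u] /=.
have su : size u = Defs.order G by have := next_size z (word S); rewrite E size_word.
have zC : z <> Copy by rewrite zE; case: ifP.
have after T : #|T| <= K -> colex (word S) (word T) ->
    z' = Copy /\ (u = word T \/ colex u (word T)).
  move=> TK ST; have eqw : size (word T) = size (word S) by rewrite !size_word.
  have [-> ->] : z' = (next z (word S)).1 /\ u = (next z (word S)).2 by rewrite E.
  rewrite zE; case: ltnP => KS; first exact: next_carry_least.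
  by apply: next_skip_least => //; rewrite !word_weight (leq_trans TK).
have bad_after T : #|T| <= K -> viol #|T| (omega_minus T) ->
    z' = Copy /\ (u = word T \/ colex u (word T)).
  move=> TK bad; case: (least T TK bad) => [TS|]; last exact: after.
  by case/negP: good; rewrite -TS.
(* A violating small set would lie after S, and then the addition could not overflow. *)
have overflow : z' <> Copy -> true = small_cuts_ok.
  move=> z'C; apply/esym/forallP => T; apply/implyP => TK; apply/negP => bad.
  by have [] := bad_after T TK bad.
case z'E: z' => /=; try by apply: overflow; rewrite z'E.
have [S1 S1u] := word_surj su.
have S1K : #|S1| <= K.
  have -> : #|S1| = count_mem true (next z (word S)).2.
    by rewrite E /= -S1u word_weight.
  rewrite zE.
  case: ltnP => KS.
    by apply: leq_trans (next_carry_weight _) _; rewrite word_weight.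
  by apply: leq_trans (next_skip_weight _) _; rewrite word_weight.
have SS1 : colex (word S) (word S1).
  by have := next_gt zC; rewrite S1u => /(_ (word S)); rewrite E z'E => /(_ erefl).
(* Without marks the matrix pass changes nothing, so a new set may start directly with [Seed]. *)
have grow0 : grow S1 set0 = set0.
  apply/setP => v; rewrite !inE /=; apply/negbTE; rewrite negb_and negbK.
  by apply/orP; right; apply/existsPn => w; rewrite inE.
have -> : [seq (b, false) | b <- u] = cells S1 set0.
  by rewrite -S1u -map_comp; apply: eq_map => v; rewrite /cell_of /= inE.
exists (later S1 * width + 2 * (Defs.order G - #|set0 : {set V}|) + 2).
  have := leq_mul (later_lt S1K SS1) (leqnn width); rewrite mulSn cards0.
  by rewrite {1}/width; move: (later S1 * width) (later S * width) => w1 w; lia.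
exists S1, set0; rewrite matrix_pass_grow; split=> //.
  move=> T TK /(bad_after T TK)[_]; rewrite -S1u => -[/word_inj->|]; first by left.
  by right.
split=> //; exists set0; last by rewrite cards0 minn0.
by split; rewrite ?sub0set // => v; rewrite inE.
Qed.

Lemma invariant_start :
  invariant (later set0 * width + 2 * Defs.order G + 2) (Seed ord0 ord0 false)
    (nseq (Defs.order G) (false, false)) (nseq (Defs.order G) (false, false)).
Proof.
have grow0 : grow set0 set0 = set0.
  apply/setP => v; rewrite !inE /=.
  by apply/existsPn => w; rewrite inE.
have word0 : word set0 = nseq (Defs.order G) false.
  by rewrite /word -[in RHS](size_enum_ord (Defs.order G)); elim: (enum V) => //= v E ->; rewrite inE.
have cells0 : cells set0 set0 = nseq (Defs.order G) (false, false).
  rewrite /cells -[in RHS](size_enum_ord (Defs.order G)); elim: (enum V) => //= v E ->.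
  by rewrite /cell_of !inE.
exists set0, set0; rewrite grow0 cells0; split=> //; first by rewrite cards0.
  move=> T _ _; have [eqw|lt] := colex_nseq (word T).
    by left; apply: word_inj; rewrite eqw size_word word0.
  by right; rewrite word0 -(size_word T).
split=> //; exists set0; last by rewrite cards0 minn0 subn0.
by split; rewrite ?sub0set // => v; rewrite inE.
Qed.

(* A set of size at most K is the set of values of a partial K-tuple. *)
Lemma small_sets_card : #|[set T : {set V} | #|T| <= K]| <= (Defs.order G).+1 ^ K.
Proof.
have -> : (Defs.order G).+1 ^ K = #|[set: {ffun 'I_K -> option V}]|.
  by rewrite cardsT card_ffun card_option !card_ord.
apply: (@leq_card_inj_in _ _ (fun T => [ffun i : 'I_K => nth None (map Some (enum T)) i])).
  by move=> T _; rewrite inE.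
move=> T1 T2; rewrite !inE => T1K T2K eqf; apply/setP => v.
suff memE T : #|T| <= K -> (v \in T) =
    [exists i : 'I_K, [ffun i : 'I_K => nth None (map Some (enum T)) i] i == Some v].
  by rewrite (memE _ T1K) (memE _ T2K) eqf.
move=> TK; apply/idP/existsP => [vT|[i]]; rewrite ?ffunE.
  have lti : index v (enum T) < size (enum T) by rewrite index_mem mem_enum.
  have ltK : index v (enum T) < K by apply: leq_trans lti _; rewrite -cardE.
  by exists (Ordinal ltK); rewrite ffunE (nth_map v) //= nth_index ?mem_enum.
rewrite -mem_enum; have [lti|] := ltnP i (size (enum T)).
  by rewrite (nth_map v) // => /eqP[<-]; apply: mem_nth.
by move=> le; rewrite nth_default // size_map.
Qed.

Lemma encode_rows : encode G = nseq (Defs.order G) true ++ false :: flatten adj_rows.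
Proof. by []. Qed.

Definition checker : tm 2 := sweeper (Seed ord0 ord0 false) phase_step phase_end.

(** At most (n + 1)^K sets, [width] = 2(n + 1) cycles for each, and 10(n + 1)^2 steps per cycle; the
    constant 65 absorbs the first set and the initialization. *)
Lemma checker_run s : 65 * (Defs.order G).+1 ^ (K + 3) <= s ->
  tm_run checker (encode G) s = Some small_cuts_ok.
Proof.
move=> le_s; pose n := Defs.order G.
have rows_n : size adj_rows = n by rewrite size_map size_enum_ord.
have rows_all : all (fun bs => size bs == n) adj_rows.
  by apply/allP => _ /mapP[x _ ->]; rewrite size_map size_enum_ord.
have fl : size (flatten adj_rows) = n * n.
  by rewrite (size_flatten_const rows_all) rows_n.
have [c run cb] := cycles_run (Seed ord0 ord0 false) rows_n rows_all invariant_step invariant_start.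
have := init_run (Seed ord0 ord0 false) phase_step phase_end n (flatten adj_rows).
rewrite -encode_rows => /runs_trans/(_ run) {}run.
apply: tm_run_runs run cb _; apply: leq_trans le_s.
have card_later : later set0 <= n.+1 ^ K.
  apply: leq_trans small_sets_card; apply/subset_leq_card/subsetP => T.
  by rewrite !inE => /andP[].
rewrite fl /cycle_time /width -/n addnC expnD.
have : 0 < n.+1 ^ K by rewrite expn_gt0.
move: (later set0) (n.+1 ^ K) card_later => l p lp p_gt0.
rewrite !expnS expn0 muln1.
have -> : 65 * (p * (n.+1 * (n.+1 * n.+1))) = 65 * p * n.+1 * n.+1 * n.+1 by rewrite !mulnA.
nia.
Qed.

End OnGraph.

End CutChecker.

(* Once t C > K, every count above C is a violation, whatever its value. *)
Lemma violates_cap (t : rat) (K : nat) : (0 < t)%R ->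
  exists C, forall s c, s <= K -> violates t s (minn C c) = violates t s c.
Proof.
(* Adding 2 ensures 1 < C, which a violation with count C requires. *)
move=> t_gt0; pose C := (Num.bound (K%:R / t)%R).+2; exists C => s c sK.
have [//|Cc] := leqP c C.
have Ct : (s%:R < t * C%:R)%R.
  have := archi_boundP (divr_ge0 (ler0n rat K) (ltW t_gt0)).
  rewrite ltr_pdivrMr // mulrC => lt.
  apply: le_lt_trans (lt_le_trans lt _); first by rewrite ler_nat.
  by rewrite ler_pM2l // ler_nat /C -addn2 leq_addr.
rewrite /violates Ct (ltn_trans _ Cc) //=.
by apply/esym/(lt_trans Ct); rewrite ltr_pM2l // ltr_nat.
Qed.

Theorem theorem1p14 (t : rat) (t_gt0 : (0 < t)%R) (t_lt : (t < 2 / 3)%R) :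
  poly_time_decidable encode (regular 3) (tough t).
Proof.
have [K cuts] := bounded_cuts_suffice t_gt0 t_lt.
have [C violC] := violates_cap K t_gt0.
exists 2, (checker K C (violates t)), (65 *: 'X^(K + 3))%R => G G3.
exists (small_cuts_ok K (violates t) G); split.
  (* The encoding has length at least n + 1, so its power dominates that of n + 1. *)
  apply: checker_run => //; rewrite hornerZ hornerXn leq_mul2l /=.
  rewrite leq_exp2r ?addn3 // size_cat size_nseq /=; lia.
split=> [/forallP ok|/toughP ok].
  by apply: cuts G3 _ => S SK; have := ok S; rewrite SK.
by apply/forallP => S; rewrite ok implybT.
Qed.
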